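(* Let $k \geq 1$ and let $\mathbf{w}$ be an infinite word over the alphabet $\{0,1,\ldots,k-1\}$. Suppose there exist a vector $v \in \mathbb{Q}^k$ and a positive integer $M$ such that $$\mu\big(\psi(\mathbf{w}[1..i]),\, i v\big) \leq M \quad \text{for all } i \geq 0.$$ Then for every integer $\alpha \geq 2$, $\mathbf{w}$ contains an abelian $\alpha$-power as a factor.
   Context: For a finite word $u$ over $\{0,\ldots,k-1\}$, $|u|_a$ denotes the number of occurrences of the letter $a$ in $u$, and the Parikh vector is $\psi(u) = (|u|_0, |u|_1, \ldots, |u|_{k-1}) \in \mathbb{Z}^k$. For vectors $u=(u_0,\ldots,u_{k-1})$, $v=(v_0,\ldots,v_{k-1})$ with real entries, $\mu(u,v) = \max_{0 \le i < k} |u_i - v_i|$. For an infinite word $\mathbf{w} = b_1 b_2 \cdots$, $\mathbf{w}[i..j] = b_i b_{i+1}\cdots b_j$, and $\mathbf{w}[1..0]$ is the empty word. An abelian $r$-power is a nonempty word $x_1 x_2 \cdots x_r$ with $|x_1| = \cdots = |x_r|$ and each $x_i$ a permutation (anagram) of $x_1$. *)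

(* Defs.v *)
From mathcomp Require Import all_boot all_order all_algebra.

Set Implicit Arguments.
Unset Strict Implicit.
Unset Printing Implicit Defensive.

Import Order.TTheory GRing.Theory Num.Theory.

Local Open Scope ring_scope.

(* The k-letter alphabet {0, ..., k-1} is 'I_k. An infinite word b_1 b_2 ... is
   a function w : nat -> A with b_n = w n.-1, so that w 0 is its first letter
   b_1. *)

(* w[i..j] = b_i ... b_j for 1 <= i; it is empty when j < i. *)
Definition factor (A : Type) (w : nat -> A) (i j : nat) : seq A :=
  [seq w n.-1 | n <- iota i (j.+1 - i)].

Definition parikh (k : nat) (u : seq 'I_k) : 'rV[int]_k :=
  \row_(a < k) (count_mem a u)%:Z.

(* Differences are taken in absolute value, so the default value 0 does not
   affect the maximum as soon as 0 < k. *)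
Definition mu (R : realDomainType) (k : nat) (u v : 'rV[R]_k) : R :=
  \big[Num.max/0]_(i < k) `|u ord0 i - v ord0 i|.

Definition abelian_power (A : eqType) (r : nat) (x : seq A) : Prop :=
  x <> [::] /\
  exists xs : seq (seq A),
    [/\ size xs = r,
        x = flatten xs,
        (forall y, y \in xs -> size y = size (head [::] xs)) &
        (forall y, y \in xs -> perm_eq y (head [::] xs))].

Definition contains_abelian_power (A : eqType) (w : nat -> A) (r : nat) : Prop :=
  exists i j : nat, (1 <= i)%N /\ abelian_power r (factor w i j).

(* Main.v *)
Require Import Defs.
From mathcomp Require Import all_boot all_order all_algebra.
From mathcomp Require Import zify ring.
Import Order.TTheory GRing.Theory Num.Theory.
Local Open Scope ring_scope.

(** Multiplying the [a]-th coordinate of [psi (w[1..i]) - i v] by the denominator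
    of [v_a] gives a bounded integer, so these vectors colour the naturals with
    finitely many colours. By van der Waerden's theorem some arithmetic
    progression of prefix lengths is monochromatic; between consecutive terms of
    common difference [d] the Parikh vector grows by [d v], so the blocks cut out
    by the progression form an abelian power. Van der Waerden's theorem is proved
    by colour focusing. *)

Section VanDerWaerden.
Local Open Scope nat_scope.

Definition mono_progression {C : Type} (c : nat -> C) (l a d : nat) : Prop :=
  0 < d /\ forall i, i <= l -> c (a + i * d) = c a.

(** [N] is chosen before [c], so that the next focusing stage can use windows of a length fixed in
    advance. *)
Definition van_der_waerden_at (l : nat) (C : finType) : Prop :=
  exists N, forall c : nat -> C,
    exists a d, [/\ a < N, d < N & mono_progression c l a d].

(* The pairs in [s] are the first terms and the differences of progressions with
   distinct colours which would all be continued by the same point [f]. *)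
Definition focused {C : eqType} (c : nat -> C) (l f : nat)
    (s : seq (nat * nat)) : Prop :=
  uniq [seq c p.1 | p <- s] /\
  forall p, p \in s -> p.1 + l.+1 * p.2 = f /\ mono_progression c l p.1 p.2.

Lemma focused_extend (C : eqType) (c : nat -> C) (l f : nat) s p :
  focused c l f s -> p \in s -> c f = c p.1 ->
  mono_progression c l.+1 p.1 p.2.
Proof.
move=> [_ hs] /hs [pf [d0 hm]] cf; split=> // i.
rewrite leq_eqVlt => /orP[/eqP->|]; first by rewrite pf.
by rewrite ltnS; apply: hm.
Qed.

(* The windows may overlap: only the equality of the windows of length [N] at
   [a + i * d] is used, not their disjointness. *)
Lemma focused_step (C : eqType) (c : nat -> C) (l N a d f : nat) s :
  0 < d -> f < N ->
  (forall i j, i <= l -> j < N -> c (a + i * d + j) = c (a + j)) ->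
  focused (fun x => c (a + x)) l f s ->
  (forall p, p \in s -> c (a + f) != c (a + p.1)) ->
  focused c l (a + f + l.+1 * d)
    ((a + f, d) :: [seq (a + p.1, p.2 + d) | p <- s]).
Proof.
move=> d0 fN win [us hs] newf; split.
  rewrite /= -map_comp us andbT; apply/mapP => -[p ps /= e].
  by move: (newf p ps); rewrite e eqxx.
move=> p; rewrite in_cons => /orP[/eqP-> /=|/mapP[[b e] qs ->] /=].
  split=> //; split=> // i il.
  by rewrite -(win i f il fN); congr c; lia.
have /= [qf [e0 hq]] := hs _ qs; split; first by lia.
split; first by lia.
(* Terms of an old progression precede its focus [f < N], so they lie in the window; the new [i]-th
   term is the old one taken in the [i]-th window. *)
move=> i il; have lt_N : b + i * e < N by nia.
rewrite -(hq i il) -(win i _ il lt_N); congr c; lia.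
Qed.

(** Induction on [r]: colouring each point by its window of length [N] gives equally spaced
    identical windows. If the focus in the first window repeats the colour of a focused progression,
    that one grows by a term; otherwise the copies of the focus form a further progression with a
    new colour. *)
Lemma focused_or_longer (l : nat) (C : finType) :
  (forall C' : finType, van_der_waerden_at l C') ->
  forall r, exists N, forall c : nat -> C,
    (exists a d, [/\ a < N, d < N & mono_progression c l.+1 a d]) \/
    (exists f s, [/\ f < N, size s = r & focused c l f s]).
Proof.
move=> vdW; elim=> [|r [N IH]].
  exists 1 => c; right; exists 0, [::]; split=> //.
have [N' hN'] := vdW {ffun 'I_N -> C}.
(* Since [a] and [d] are below [N'] and [f] is below [N], this exceeds the new focus
   [a + f + l.+1 * d]. *)
exists (N' + N + l.+1 * N') => c.
have [a [d [aN' dN' [d0 hw]]]] := hN' (fun x => [ffun j : 'I_N => c (x + j)]).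
have win i j : i <= l -> j < N -> c (a + i * d + j) = c (a + j).
  move=> il jN; have /ffunP/(_ (Ordinal jN)) := hw i il.
  by rewrite !ffunE.
have shift l' b e : mono_progression (fun x => c (a + x)) l' b e ->
    mono_progression c l' (a + b) e.
  by case=> e0 hm; split=> // i /hm <-; rewrite addnA.
have [[b [e [bN eN hm]]]|[f [s [fN ss hf]]]] := IH (fun x => c (a + x)).
  by left; exists (a + b), e; split; [lia | lia | exact: shift].
have [/hasP[p ps /eqP cf]|/hasPn newf] :=
  boolP (has (fun p => c (a + f) == c (a + p.1)) s).
  left; exists (a + p.1), p.2.
  have [pf _] := hf.2 _ ps.
  by split; [nia | nia | apply/shift/(focused_extend _ _ _ _ _ _ hf ps cf)].
right; exists (a + f + l.+1 * d), ((a + f, d) :: [seq (a + p.1, p.2 + d) | p <- s]).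
split; [nia | by rewrite /= size_map ss |].
exact: (focused_step _ _ _ _ _ _ _ _ d0 fN win hf newf).
Qed.

Theorem van_der_waerden (l : nat) (C : finType) : van_der_waerden_at l C.
Proof.
elim: l C => [|l IH] C.
  exists 2 => c; exists 0, 1; split=> //; split=> // i.
  by rewrite leqn0 => /eqP->.
(* More focused progressions than colours cannot have distinct colours, so only the longer
   progression remains. *)
have [N hN] := focused_or_longer l C IH #|C|.+1.
exists N => c; case: (hN c) => // -[f [s [_ ss [us _]]]].
have := max_card [in [seq c p.1 | p <- s]].
by rewrite (card_uniqP us) size_map ss ltnn.
Qed.

End VanDerWaerden.

Lemma bounded_int_progression (I : finType) (B l : nat) (f : nat -> I -> int) :
  (forall n i, `|f n i| <= B%:Z) ->
  exists a d, (0 < d)%N /\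
    forall j, (j <= l)%N -> forall i, f (a + j * d)%N i = f a i.
Proof.
move=> hB.
(* Adding [B] moves the values into [0..2B], where [absz] and [inord] lose nothing. *)
have [N hN] := van_der_waerden l {ffun I -> 'I_(2 * B).+1}.
have [a [d [_ _ [d0 hm]]]] :=
  hN (fun n => [ffun i => inord (absz (f n i + B%:Z))]).
exists a, d; split=> // j /hm /ffunP hj i.
move: (hj i) (hB (a + j * d)%N i) (hB a i); rewrite !ffunE => /(congr1 val) /=.
by move=> e h1 h2; move: e; rewrite !inordK; lia.
Qed.

Section Words.
Context {A : eqType}.
Implicit Types w : nat -> A.

Lemma size_factor w p d : size (factor w p.+1 (p + d)) = d.
Proof. by rewrite size_map size_iota; lia. Qed.

Lemma factor_cat w p q r :
  factor w p.+1 (p + q) ++ factor w (p + q).+1 (p + q + r) =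
  factor w p.+1 (p + q + r).
Proof.
rewrite /factor -map_cat; congr map.
have -> : ((p + q).+1 - p.+1 = q)%N by lia.
have -> : ((p + q + r).+1 - (p + q).+1 = r)%N by lia.
have -> : ((p + q + r).+1 - p.+1 = q + r)%N by lia.
by rewrite iotaD addSn.
Qed.

Lemma count_factor w (a : A) p q :
  (count_mem a (factor w 1 (p + q)) =
   count_mem a (factor w 1 p) + count_mem a (factor w p.+1 (p + q)))%N.
Proof. by rewrite -count_cat -(factor_cat w 0 p q). Qed.

Lemma flatten_blocks w p d n :
  flatten [seq factor w (p + j * d).+1 (p + j * d + d) | j <- iota 0 n] =
  factor w p.+1 (p + n * d).
Proof.
elim: n => [|n IH]; first by rewrite /factor mul0n addn0 subnn.
rewrite -addn1 iotaD map_cat flatten_cat IH /= cats0 add0n factor_cat.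
by congr factor; lia.
Qed.

Lemma abelian_power_of_blocks w p d n :
  (0 < n)%N -> (0 < d)%N ->
  (forall a j, (j < n)%N ->
     count_mem a (factor w (p + j * d).+1 (p + j * d + d)) =
     count_mem a (factor w p.+1 (p + d))) ->
  contains_abelian_power w n.
Proof.
move=> n0 d0 hcount; exists p.+1, (p + n * d)%N; split=> //; split.
  by move/(congr1 size); rewrite size_factor /=; lia.
exists [seq factor w (p + j * d).+1 (p + j * d + d) | j <- iota 0 n].
have -> : head [::] [seq factor w (p + j * d).+1 (p + j * d + d) | j <- iota 0 n] =
    factor w p.+1 (p + d).
  by case: n n0 {hcount} => //= n _; rewrite mul0n addn0.
split.
- by rewrite size_map size_iota.
- by rewrite flatten_blocks.
- by move=> _ /mapP[j _ ->]; rewrite !size_factor.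
move=> _ /mapP[j jn ->]; rewrite mem_iota add0n /= in jn.
by rewrite /perm_eq; apply/allP => a _; rewrite /= hcount.
Qed.

End Words.

Lemma mu_ge_coord (R : realDomainType) k (u v : 'rV[R]_k) (a : 'I_k) :
  `|u ord0 a - v ord0 a| <= mu u v.
Proof. by rewrite /mu (bigD1 a) //= le_max lexx. Qed.

(** Clearing the denominator makes the deviation an integer, so that a bound leaves finitely many
    values. *)
Lemma scaled_deviation_bound (x : rat) (c i M : nat) :
  `|c%:R - i%:R * x| <= M%:R ->
  `|denq x * c%:Z - i%:Z * numq x| <= denq x * M%:Z.
Proof.
move=> h; rewrite -(ler_int rat) intr_norm rmorphB /= !rmorphM /= numqE.
have -> : (denq x)%:~R * c%:~R - i%:~R * (x * (denq x)%:~R) =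
   (denq x)%:~R * (c%:R - i%:R * x) :> rat by rewrite -!pmulrn; ring.
by rewrite normrM ger0_norm ?ler0z ?denq_ge0 // ler_pM2l ?ltr0z ?denq_gt0.
Qed.

(** For prefix counts [x] and [y], equal deviations at both ends of a block fix its count [z]
    independently of [p]. *)
Lemma deviation_increment (q n : int) (p d x y z : nat) :
  y = (x + z)%N ->
  q * y%:Z - (p + d)%N%:Z * n = q * x%:Z - p%:Z * n ->
  q * z%:Z = d%:Z * n.
Proof. by move=> ->; rewrite !PoszD; lia. Qed.

Theorem theorem2 (k : nat) (hk : (1 <= k)%N) (w : nat -> 'I_k)
  (hw : exists (v : 'rV[rat]_k) (M : nat), (0 < M)%N /\
     forall i : nat,
       mu (map_mx intr (parikh (factor w 1 i))) (i%:R *: v) <= M%:R) :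
  forall alpha : nat, (2 <= alpha)%N -> contains_abelian_power w alpha.
Proof.
move=> alpha alpha2; have [v [M [_ hM]]] := hw.
pose cnt i a := count_mem a (factor w 1 i).
pose dev i a : int := denq (v ord0 a) * (cnt i a)%:Z - i%:Z * numq (v ord0 a).
have dev_bound i a : `|dev i a| <= (\sum_b `|denq (v ord0 b)| * M)%N%:Z.
  have /scaled_deviation_bound /le_trans : `|(cnt i a)%:R - i%:R * v ord0 a| <= M%:R.
    by have := le_trans (mu_ge_coord _ _ _ _ a) (hM i); rewrite !mxE.
  apply; rewrite (bigD1 a) //= PoszD PoszM gez0_abs ?denq_ge0 //.
  by rewrite lerDl.
(* The [alpha] blocks have [alpha + 1] endpoints, the terms for [j] from 0 to [alpha]. *)
have [p [d [d0 hdev]]] := bounded_int_progression _ _ alpha _ dev_bound.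
apply: (@abelian_power_of_blocks _ w p d) => // [|a j jn]; first by lia.
have q0 := denq_gt0 (v ord0 a).
have := count_factor w a (p + j * d) d; have := count_factor w a p d.
have := hdev j (ltnW jn) a; have := hdev j.+1 jn a.
have := hdev 1%N (ltnW alpha2) a; rewrite mul1n /dev /cnt mulSnr addnA.
move=> e1 eS ej c1 cS.
(* Times the nonzero denominator, both counts equal [d] times the numerator. *)
apply/eqP; rewrite -eqz_nat -(inj_eq (mulfI (lt0r_neq0 q0))); apply/eqP.
rewrite (deviation_increment _ _ _ _ _ _ _ c1 e1).
by rewrite (deviation_increment _ _ _ _ _ _ _ cS (etrans eS (esym ej))).
Qed.
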